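(* Let $K$ be a field and let $R=K[x_1,\ldots,x_r]/I_\Delta$ be the $d$-dimensional face ring of a simplicial complex $\Delta$ on $r$ vertices. Let $J=(x_1^{v_1},\ldots,x_r^{v_r})R$, where $v_i>0$ are integers for all $i$. Then \[ \lim_{q\to\infty}\frac{e_i(J^{[q]})}{q^d}=0\quad\text{for all } i=1,\ldots,d, \] where $q$ ranges over all positive integers, and for all integers $k\ge1$ the generalized Hilbert-Kunz multiplicity of $J^k$ is \[ e_{HK}(J^k)=e_0(J)\binom{k+d-1}{d}. \]
   Context: There is no restriction on the characteristic of $K$. The face ring (Stanley-Reisner ring) of a simplicial complex $\Delta$ on vertices $x_1,\dots,x_r$ is $K[x_1,\ldots,x_r]/I_\Delta$, where $I_\Delta$ is the ideal generated by the squarefree monomials $\prod_{i\in F}x_i$ with $F\notin\Delta$; equivalently $I_\Delta=\bigcap_{F}(x_i\mid i\notin F)$ over the facets $F$ of $\Delta$. For a positive integer $q$, the generalized Frobenius power, with respect to the given generators, is $J^{[q]}=(x_1^{qv_1},\ldots,x_r^{qv_r})R$. For $J^k$ one uses the generators given by the $k$-fold products of the generators $x_i^{v_i}$, so that $(J^k)^{[q]}=(J^{[q]})^k$. The generalized Hilbert-Kunz function of $J^k$ is $q\mapsto\ell(R/(J^{[q]})^k)$, where $\ell$ denotes length, and the generalized Hilbert-Kunz multiplicity is $e_{HK}(J^k)=\lim_{q\to\infty}\ell(R/(J^{[q]})^k)/q^d$, with $q$ ranging over positive integers, whenever the limit exists. For an ideal $\mathfrak a$ of $R$ primary to the maximal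 homogeneous ideal, $\ell(R/\mathfrak a^n)$ agrees for large $n$ with a polynomial $\sum_{i=0}^d(-1)^ie_i(\mathfrak a)\binom{n+d-1-i}{d-i}$; the integers $e_i(\mathfrak a)$ are the Hilbert-Samuel coefficients of $\mathfrak a$. *)

(* Defs.v *)
From HB Require Import structures.
From mathcomp Require Import all_boot all_order all_algebra.
From mathcomp Require Import generic_quotient ring_quotient.
From mathcomp Require Import all_classical all_reals all_analysis.
(* The notations of mpoly clash with those of mathcomp-analysis. *)
From mathcomp Require Import -(notations) mpoly.

Set Implicit Arguments.
Unset Strict Implicit.
Unset Printing Implicit Defensive.

Import Order.TTheory GRing.Theory Num.Theory.
Import numFieldNormedType.Exports.

Local Open Scope classical_set_scope.
Local Open Scope ring_scope.

Section Ideals.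
Variable A : comNzRingType.
Implicit Types (I J : set A).

(* Unlike [idealr], the unit ideal is allowed. *)
Definition is_ideal I : Prop :=
  [/\ I 0, forall a b, I a -> I b -> I (a + b) & forall a b, I b -> I (a * b)].

Definition is_prime_ideal I : Prop :=
  [/\ is_ideal I, ~ I 1 & forall a b, I (a * b) -> I a \/ I b].

Definition ideal_gen (S : set A) : set A := smallest is_ideal S.

Definition ideal_mul I J : set A := ideal_gen [set a * b | a in I & b in J].

Fixpoint ideal_pow I (n : nat) : set A :=
  if n is m.+1 then ideal_mul (ideal_pow I m) I else setT.

(* There is a chain c_0 < c_1 < ... < c_n of sets satisfying C. *)
Definition has_chain (C : set A -> Prop) (n : nat) : Prop :=
  exists c : nat -> set A,
    (forall i, (i <= n)%N -> C (c i)) /\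
    (forall i, (i < n)%N -> c i `<` c i.+1).

Definition is_krull_dim (d : nat) : Prop :=
  has_chain is_prime_ideal d /\
  forall n, has_chain is_prime_ideal n -> (n <= d)%N.

(* The length of the A-module A / I (possibly +oo): the submodules of A / I
   are the ideals of A containing I. *)
Definition colength (R : realType) I : \bar R :=
  ereal_sup [set (n%:R : R)%:E | n in
    has_chain [set J | is_ideal J /\ I `<=` J]].

(* e_0, ..., e_d are the coefficients of a polynomial that gives the length of
   A / I^n for all large n.  When n > 0 the subtractions do not truncate. *)
Definition hilbert_samuel (R : realType) (d : nat) I
    (e : {ffun 'I_d.+1 -> int}) : Prop :=
  \forall n \near \oo,
    colength R (ideal_pow I n) =
    ((\sum_(i < d.+1) (-1) ^+ i * e i * ('C(n + d - 1 - i, d - i))%:Z)%:~R : R)%:E.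

(* The zero family if there is no such polynomial. *)
Definition hs_coef (R : realType) (d : nat) I : {ffun 'I_d.+1 -> int} :=
  xget [ffun=> 0] [set e | hilbert_samuel R I e].

Definition frobenius_power (T : Type) (g : T -> A) (q : nat) : set A :=
  ideal_gen (range (fun t => g t ^+ q)).

End Ideals.

(* Not every i : 'I_r is required to be a vertex, i.e. [set i] to be a face. *)
Record simplicial_complex (r : nat) := SimplicialComplex {
  faces :> {set {set 'I_r}};
  faces0 : finset.set0 \in faces;
  faces_sub : forall F G : {set 'I_r},
    G \subset F -> F \in faces -> G \in faces }.

Section FaceRing.
Variables (K : fieldType) (r : nat) (Delta : simplicial_complex r).

Local Notation P := (mpoly r K).

Definition stanley_reisner_set : set P :=
  ideal_gen [set (\prod_(i in F) mpolyX K (mnm1 i) : P) |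
             F in [set F : {set 'I_r} | F \notin Delta]].

Definition stanley_reisner : {pred P} := fun p => p \in stanley_reisner_set.

Lemma stanley_reisner_closed : idealr_closed stanley_reisner.
Proof.
have SR : is_ideal stanley_reisner_set.
  split=> [J [[]]//|a b Ja Jb J JJ|a b Jb J JJ]; have [[J0 JD JM] _] := JJ.
    by apply: JD; [apply: Ja|apply: Jb].
  by apply: JM; apply: Jb.
have [SR0 SRD SRM] := SR; split; first exact: mem_set.
  apply/negP => /set_mem /(_ [set p | meval (fun=> 0) p = 0]) H.
  suff : meval (fun=> 0 : K) (1 : P) = 0.
    by rewrite meval1 => /eqP; rewrite oner_eq0.
  apply: H; split=> [|_ [F FD <-]] /=.
    split=> [|a b /= a0 b0|a b /= b0]; first exact: meval0.
      by rewrite mevalD a0 b0 addr0.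
    by rewrite mevalM b0 mulr0.
  have [F0|[i iF]] := finset.set_0Vmem F; first by case/negP: FD; rewrite F0 faces0.
  by rewrite rmorph_prod /= (bigD1 i) //= mevalXU mul0r.
move=> a u v /set_mem Hu /set_mem Hv; apply: mem_set.
by apply: SRD => //; apply: SRM.
Qed.

HB.instance Definition _ := isIdealr.Build P stanley_reisner
  stanley_reisner_closed.

Definition face_ring : comNzRingType := {ideal_quot stanley_reisner}.

Definition face_var (i : 'I_r) : face_ring :=
  \pi_({ideal_quot stanley_reisner})%qT (mpolyX K (mnm1 i)).

End FaceRing.

(* Main.v *)
From HB Require Import structures.
Require Import Defs.
From mathcomp Require Import all_boot all_order all_algebra.
From mathcomp Require Import generic_quotient ring_quotient.
From mathcomp Require Import all_classical all_reals all_analysis.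
From mathcomp Require Import zify ring.
From mathcomp Require Import -(notations) mpoly.

Set Implicit Arguments.
Unset Strict Implicit.
Unset Printing Implicit Defensive.

Import Order.TTheory GRing.Theory Num.Theory.
Import numFieldNormedType.Exports.

Local Open Scope classical_set_scope.
Local Open Scope ring_scope.

(** Everything is monomial.  The monomials x^m with support in Delta form a
    K-basis of the face ring, and J^[q] is generated by powers of the
    variables, so with w_i = q v_i the k-th power of J^[q] is spanned by the
    x^m whose floor degree, the sum of the floors of m_i / w_i, is at least k
    ([frobenius_pow_mono_ideal]).  The colength of an ideal spanned by
    monomials is the number of the remaining monomials
    ([colength_face_mono_ideal]), so l(R / (J^[q])^k) counts the exponents with
    support in Delta and floor degree less than k.

    For exponents supported in a fixed set G that count is
    (prod_(i in G) w_i) * C(k - 1 + |G|, |G|) ([size_bounded_exps]), and the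
    indicator of Delta is an integral combination chi of the indicators of the
    power sets of its faces ([indicator_expansion]).  Hence, for all k >= 1,
      l(R / (J^[q])^k)
        = sum_(G in Delta) chi(G) q^|G| (prod_(i in G) v_i) C(k - 1 + |G|, |G|).
    Removing the elements of a face G one by one gives a chain of primes of
    length |G| ([face_prime_chain]), so every face has at most d elements, and
    grouping the faces by d - |G| = i gives (-1)^i e_i(J^[q]) as q^(d - i) times
    an integer that does not depend on q ([colength_frobenius_pow]).  These coefficients are well defined
    because the polynomials C(n + j, j) are linearly independent
    ([binomial_basis]).  Dividing by q^d, only i = 0 survives in the limit, and
    both limits follow. *)

Local Notation "a +m b" := (mnm_add a b) (at level 50, left associativity).
Local Notation mpow i x := (mnm_muln (mnm1 i) x).

(** * Counting exponents by floor degree *)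

Definition exp_support (r : nat) (m : multinom r) : {set 'I_r} :=
  [set i | m i != 0%N].

(** For w > 0, the largest k such that x^m lies in the k-th power of the ideal
    of the polynomial ring generated by the x_i ^ w_i. *)
Definition floor_degree (r : nat) (w : 'I_r -> nat) (m : multinom r) : nat :=
  \sum_i m i %/ w i.

Lemma mpowE (r : nat) (i j : 'I_r) (x : nat) :
  mpow i x j = if i == j then x else 0%N.
Proof. by rewrite mulmnE mnm1E; case: eqP => _; rewrite ?mul1n ?mul0n. Qed.

Lemma exp_supportD (r : nat) (a b : multinom r) :
  exp_support (a +m b) = exp_support a :|: exp_support b.
Proof. by apply/setP => i; rewrite !inE mnmDE addn_eq0 negb_and. Qed.

Lemma floor_degreeD (r : nat) (w : 'I_r -> nat) (a b : multinom r) :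
  (floor_degree w a + floor_degree w b <= floor_degree w (a +m b))%N.
Proof.
rewrite /floor_degree -big_split leq_sum // => i _.
by rewrite mnmDE; have [->|w0] := posnP (w i); rewrite ?divn0 // divnD // leq_addr.
Qed.

Lemma floor_degree_pow (r : nat) (w : 'I_r -> nat) (j : 'I_r) (x : nat)
    (m : multinom r) :
  m j = 0%N -> floor_degree w (m +m mpow j x) = (floor_degree w m + x %/ w j)%N.
Proof.
move=> mj; rewrite /floor_degree (bigD1 j) //= [in RHS](bigD1 j) //=.
rewrite mnmDE mpowE eqxx mj div0n !add0n addnC; congr (_ + _)%N.
by apply: eq_bigr => i ij; rewrite mnmDE mpowE eq_sym (negbTE ij) addn0.
Qed.

Lemma floor_degree_shift (r : nat) (w : 'I_r -> nat) (i : 'I_r) (m : multinom r) :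
  (0 < w i)%N -> floor_degree w (m +m mpow i (w i)) = (floor_degree w m).+1.
Proof.
move=> w0; rewrite /floor_degree (bigD1 i) //= [in RHS](bigD1 i) //= -addSn.
congr (_ + _)%N; first by rewrite mnmDE mpowE eqxx divnDr // divnn w0 addn1.
by apply: eq_bigr => j ij; rewrite mnmDE mpowE eq_sym (negbTE ij) addn0.
Qed.

(** The exponents supported in l of floor degree less than k, for k > 0
    ([mem_bounded_exps]).  An exponent x of the first variable j uses up x / w_j
    of the floor degree; the range x < k * w_j keeps the remaining bound
    positive. *)
Fixpoint bounded_exps (r : nat) (w : 'I_r -> nat) (l : seq 'I_r) (k : nat) :
    seq (multinom r) :=
  if l is j :: l' then
    [seq m +m mpow j x | x <- iota 0 (k * w j), m <- bounded_exps w l' (k - x %/ w j)]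
  else [:: mnm0].

Section BoundedExps.
Variables (r : nat) (w : 'I_r -> nat).
Hypothesis w_gt0 : forall i, (0 < w i)%N.

Lemma mem_bounded_exps (l : seq 'I_r) (k : nat) (m : multinom r) :
  uniq l -> (0 < k)%N ->
  (m \in bounded_exps w l k) = (exp_support m \subset l) && (floor_degree w m < k)%N.
Proof.
elim: l k m => [|j l IH] k m /=.
  move=> _ k0; rewrite inE; apply/eqP/andP => [->|[/fintype.subsetP m0 _]].
    split; first by apply/fintype.subsetP => i; rewrite inE mnm0E.
    by rewrite /floor_degree big1 // => i _; rewrite mnm0E div0n.
  apply/mnmP => i; rewrite mnm0E; apply/eqP/negPn/negP => mi.
  by have := m0 i; rewrite inE mi => /(_ isT).
move=> /andP[jl ul] k0; apply/allpairsPdep/andP.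
  move=> [x [m' [+ + ->]]]; rewrite mem_iota /= add0n -ltn_divLR // => xk.
  rewrite IH ?subn_gt0 // => /andP[/fintype.subsetP m'l m'k].
  have m'j : m' j = 0%N.
    by apply/eqP/negPn/negP => m'j; case/negP: jl; apply: m'l; rewrite inE.
  split; last by rewrite floor_degree_pow // addnC -ltn_subRL.
  rewrite exp_supportD; apply/fintype.subsetP => i; rewrite !inE mpowE => /orP[mi|].
    by rewrite m'l ?orbT // inE.
  by rewrite [j == i]eq_sym; case: (i == j).
move=> [/fintype.subsetP mjl mk].
pose m' := Multinom [tuple (if i == j then 0%N else m i) | i < r].
have m'E i : m' i = if i == j then 0%N else m i by rewrite mnmE.
have mE : m = m' +m mpow j (m j).
  apply/mnmP => i; rewrite mnmDE mpowE m'E [j == i]eq_sym.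
  by have [->|_] := eqVneq i j; rewrite ?addn0.
have mlE : floor_degree w m = (floor_degree w m' + m j %/ w j)%N.
  by rewrite {1}mE floor_degree_pow // m'E eqxx.
have mjk : (m j %/ w j < k)%N by apply: leq_ltn_trans mk; rewrite mlE leq_addl.
exists (m j), m'; split=> //; first by rewrite mem_iota /= add0n -ltn_divLR.
rewrite IH ?subn_gt0 //; apply/andP; split.
  apply/fintype.subsetP => i; rewrite inE m'E; have [//|ij mi] := eqVneq i j.
  by have := mjl i; rewrite !inE mi (negbTE ij) => /(_ isT).
by rewrite ltn_subRL addnC -mlE.
Qed.

Lemma bounded_exps_uniq (l : seq 'I_r) (k : nat) : uniq l -> (0 < k)%N ->
  uniq (bounded_exps w l k).
Proof.
elim: l k => [//|j l IH] k /= /andP[jl ul] k0.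
have memj x m : x \in iota 0 (k * w j) -> m \in bounded_exps w l (k - x %/ w j) ->
    m j = 0%N.
  rewrite mem_iota /= add0n -ltn_divLR // => xk.
  rewrite mem_bounded_exps ?subn_gt0 // => /andP[/fintype.subsetP ml _].
  by apply/eqP/negPn/negP => mj; case/negP: jl; apply: ml; rewrite inE.
apply: allpairs_uniq_dep; first exact: iota_uniq.
  move=> x; rewrite mem_iota /= add0n -ltn_divLR // => xk.
  by rewrite IH // subn_gt0.
move=> _ _ /allpairsPdep[x [m [xi ml ->]]] /allpairsPdep[y [m' [yi m'l ->]]] /=.
move=> E; have xy : x = y.
  move/mnmP/(_ j): E; rewrite !mnmDE !mpowE eqxx.
  by rewrite (memj x m) // (memj y m').
by move: E; rewrite xy => /addIm ->.
Qed.

Lemma sum_divn (F : nat -> nat) (k v : nat) : (0 < v)%N ->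
  (\sum_(0 <= x < k * v) F (x %/ v) = v * \sum_(0 <= b < k) F b)%N.
Proof.
move=> v0; rewrite big_nat_mul big_distrr; apply: eq_bigr => b _.
rewrite (eq_big_nat _ _ (F2 := fun=> F b)).
  by rewrite sum_nat_const_nat mulSn addnK.
move=> x /andP[bx xb]; congr F; apply/eqP.
by rewrite eqn_leq leq_divRL // bx andbT -ltnS ltn_divLR.
Qed.

Lemma hockey_stick (k s : nat) :
  (\sum_(0 <= b < k.+1) 'C(k - b + s, s) = 'C(k + s.+1, s.+1))%N.
Proof.
elim: k => [|k IH]; first by rewrite big_nat1 add0n !binn.
rewrite big_nat_recl // subn0 (eq_big_nat _ _ (F2 := fun b => 'C(k - b + s, s))) //.
by rewrite IH (addSnnS k s) [in RHS]addSn binS addnC.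
Qed.

(** Every value b of x / w_j is taken by w_j exponents x, so adding a variable
    multiplies the count by w_j and sums it over the bounds k - b, which raises
    the binomial coefficient by the hockey stick identity. *)
Lemma size_bounded_exps (l : seq 'I_r) (k : nat) :
  size (bounded_exps w l k.+1) = ((\prod_(i <- l) w i) * 'C(k + size l, size l))%N.
Proof.
elim: l k => [|j l IH] k; first by rewrite big_nil mul1n bin0.
rewrite size_allpairs_dep sumnE big_map -[(k.+1 * _)%N]subn0.
rewrite -/(index_iota 0 (k.+1 * w j)%N).
rewrite (sum_divn (fun b => size (bounded_exps w l (k.+1 - b)%N))) // big_cons -mulnA.
congr (_ * _)%N; rewrite -hockey_stick big_distrr.
by apply: eq_big_nat => b /andP[_ bk]; rewrite subSn // IH.
Qed.

End BoundedExps.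

(** Inclusion-exclusion: Delta is the union of the power sets of its faces, and
    the product of the indicators of the power sets of F and G is that of the
    power set of F :&: G, again a face.  The induction adds the faces one at a
    time. *)
Lemma indicator_expansion (r : nat) (D : simplicial_complex r) :
  exists chi : {set 'I_r} -> int,
    (forall G, G \notin D -> chi G = 0) /\
    (forall S : {set 'I_r}, (S \in D)%:R = \sum_G chi G * (S \subset G)%:R).
Proof.
suff H (s : seq {set 'I_r}) : {subset s <= D} ->
    exists chi : {set 'I_r} -> int,
      (forall G, G \notin D -> chi G = 0) /\
      (forall S : {set 'I_r},
         (has (fun F : {set 'I_r} => S \subset F) s)%:R
         = \sum_G chi G * (S \subset G)%:R).
  have [|chi [chi0 chiE]] := H (enum D); first by move=> F; rewrite mem_enum.
  exists chi; split=> // S; rewrite -chiE; congr (_ %:R); congr nat_of_bool.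
  apply/idP/hasP => [SD|[F]]; first by exists S; rewrite ?mem_enum.
  by rewrite mem_enum => FD SF; apply: faces_sub SF FD.
elim: s => [_|F s IH sD].
  by exists (fun=> 0); split=> // S; rewrite big1 // => G _; rewrite mul0r.
have [|chi [chi0 chiE]] := IH; first by move=> G Gs; apply: sD; rewrite inE Gs orbT.
have FD : F \in D by apply: sD; rewrite inE eqxx.
(* 1_(X or Y) = 1_X + 1_Y - 1_X * 1_Y, with X the new power set. *)
exists (fun H => (H == F)%:R + chi H - \sum_(G | G :&: F == H) chi G); split.
  move=> G GD; rewrite chi0 // big1 => [|H /eqP HG].
    by case: eqP GD => // ->; rewrite FD.
  rewrite chi0 //; apply: contra GD => HD.
  by rewrite -HG; apply: faces_sub HD; apply: finset.subsetIl.
move=> S; under eq_bigr do rewrite mulrBl mulrDl mulr_suml.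
rewrite sumrB big_split /= -chiE.
have -> : \sum_G (G == F)%:R * (S \subset G)%:R = (S \subset F)%:R :> int.
  rewrite (bigD1 F) //= eqxx mul1r big1 ?addr0 // => G /negbTE->.
  by rewrite mul0r.
have -> : \sum_H \sum_(G | G :&: F == H) chi G * (S \subset H)%:R
    = (has (fun F : {set 'I_r} => S \subset F) s)%:R * (S \subset F)%:R :> int.
  rewrite (exchange_big_dep xpredT) //= chiE mulr_suml; apply: eq_bigr => G _.
  rewrite (big_pred1 (G :&: F)) => [|H]; last by rewrite eq_sym.
  by rewrite -mulrA finset.subsetI -natrM mulnb.
by case: (S \subset F) => /=; rewrite ?mulr1 ?mulr0 ?subr0 ?add0r // addrK.
Qed.

Lemma natr_count (T : Type) (a : pred T) (s : seq T) :
  (count a s)%:R = \sum_(x <- s) (a x)%:R :> int.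
Proof. by elim: s => [|x s IH]; rewrite ?big_nil // big_cons /= natrD IH. Qed.

(** Summing the indicator expansion over all exponents of floor degree less
    than k reduces the count over Delta to the counts over sets G.  The
    combination chi is the same for all w and k: this uniformity is what makes
    the length a polynomial in both q and k. *)
Lemma count_face_exps (r : nat) (D : simplicial_complex r) :
  exists chi : {set 'I_r} -> int, (forall G, G \notin D -> chi G = 0) /\
    forall (w : 'I_r -> nat) (k : nat), (forall i, (0 < w i)%N) -> (0 < k)%N ->
    exists2 s : seq (multinom r), uniq s &
      (forall m, (m \in s) = (exp_support m \in D) && (floor_degree w m < k)%N) /\
      (size s)%:Z = \sum_G chi G *
                   ((\prod_(i in G) w i) * 'C(k.-1 + #|G|, #|G|))%N%:Z.
Proof.
have [chi [chi0 chiE]] := indicator_expansion D.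
exists chi; split=> // w [//|k] w0 _ /=.
pose A := bounded_exps w (enum [set: 'I_r]) k.+1.
have memA m : (m \in A) = (floor_degree w m < k.+1)%N.
  rewrite mem_bounded_exps ?enum_uniq // andb_idl // => _.
  by apply/fintype.subsetP => i _; rewrite mem_enum inE.
exists [seq m <- A | exp_support m \in D].
  by rewrite filter_uniq // bounded_exps_uniq // enum_uniq.
split=> [m|]; first by rewrite mem_filter memA.
rewrite -natz size_filter natr_count.
rewrite (eq_bigr _ (fun m _ => chiE (exp_support m))) exchange_big; apply: eq_bigr => G _ /=.
rewrite -mulr_sumr -natr_count -size_filter natz; congr (_ * Posz _).
rewrite [in RHS]cardE -[\prod_(i in G) _]big_enum -size_bounded_exps //.
apply/perm_size/uniq_perm.
- by rewrite filter_uniq // bounded_exps_uniq // enum_uniq.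
- by rewrite bounded_exps_uniq // enum_uniq.
move=> m; rewrite mem_filter memA mem_bounded_exps ?enum_uniq //; congr (_ && _).
by apply: eq_subset_r => i; rewrite mem_enum.
Qed.

(** * Ideals spanned by monomials *)

Section IdealGen.
Variable A : comNzRingType.

Lemma is_ideal_gen (S : set A) : is_ideal (ideal_gen S).
Proof.
split=> [J [[]]//|a b Ja Jb J JJ|a b Jb J JJ]; have [[J0 JD JM] _] := JJ.
  by apply: JD; [apply: Ja|apply: Jb].
by apply: JM; apply: Jb.
Qed.

Lemma sub_ideal_gen (S : set A) : S `<=` ideal_gen S.
Proof. by move=> a Sa J [_]; apply. Qed.

Lemma ideal_gen_sub (S I : set A) : is_ideal I -> S `<=` I -> ideal_gen S `<=` I.
Proof. by move=> I_ SI a; apply. Qed.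

Lemma ideal_sum (I : set A) (T : Type) (s : seq T) (P : pred T) (F : T -> A) :
  is_ideal I -> (forall t, P t -> I (F t)) -> I (\sum_(t <- s | P t) F t).
Proof. by move=> [I0 ID _] IF; apply: big_ind. Qed.

Lemma ideal_sub (I : set A) (a b : A) : is_ideal I -> I a -> I b -> I (a - b).
Proof. by move=> [_ ID IM] Ia Ib; apply: ID => //; rewrite -mulN1r; apply: IM. Qed.

End IdealGen.

Section MonomialIdeals.
Variables (K : fieldType) (r : nat).
Implicit Types (m a b : multinom r) (T : pred (multinom r)).
Local Notation P := (mpoly r K).
Local Notation mX := (@mpolyX r K).

Definition up_closed T : Prop := forall a b, T a -> T (a +m b).

(** The K-span of the monomials with exponent in T. *)
Definition mono_ideal T : set P := [set p | forall m, mcoeff m p != 0 -> T m].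

Lemma mono_idealX T m : mono_ideal T (mX m) <-> T m.
Proof.
split=> [|Tm m']; first by apply; rewrite mcoeffX eqxx oner_eq0.
by rewrite mcoeffX; have [<-|_ /eqP] := eqVneq m m'.
Qed.

Lemma is_ideal_mono T : up_closed T -> is_ideal (mono_ideal T).
Proof.
move=> upT; split=> [m|p q Tp Tq m|p q Tq m]; first by rewrite mcoeff0 eqxx.
  rewrite mcoeffD => pq0; have [p0|/Tp//] := eqVneq (mcoeff m p) 0.
  by move: pq0; rewrite p0 add0r; apply: Tq.
rewrite -mcoeff_msupp => /msuppM_le /allpairsP[[a b] /= [_ bq ->]].
by rewrite addmC; apply/upT/Tq; rewrite -mcoeff_msupp.
Qed.

(** Used both for the identity of the polynomial ring and for its projection
    onto the face ring. *)
Lemma mono_ideal_sub (A : comNzRingType) (f : {rmorphism P -> A}) (I : set A) T :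
  is_ideal I -> (forall m, T m -> I (f (mX m))) -> mono_ideal T `<=` f @^-1` I.
Proof.
move=> I_ IX p Tp; rewrite /preimage /= (mpolyE p) rmorph_sum /= big_seq.
apply: ideal_sum => // m mp; rewrite -mul_mpolyC rmorphM /=.
by have [_ _] := I_; apply; apply/IX/Tp; rewrite -mcoeff_msupp.
Qed.

End MonomialIdeals.

Arguments mono_ideal K {r} T.
Arguments is_ideal_mono K {r T}.

Section FaceRingIdeals.
Variables (K : fieldType) (r : nat) (D : simplicial_complex r).
Implicit Types (m a b : multinom r) (T : pred (multinom r)).
Local Notation P := (mpoly r K).
Local Notation A := (face_ring K D).
Local Notation mX := (@mpolyX r K).

Definition nonface : pred (multinom r) := fun m => exp_support m \notin D.

Lemma nonface_up : up_closed nonface.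
Proof.
move=> a b; rewrite /nonface; apply: contra; rewrite exp_supportD.
by apply: faces_sub; apply: finset.subsetUl.
Qed.

Definition indic (F : {set 'I_r}) : multinom r :=
  Multinom [tuple nat_of_bool (i \in F) | i < r].

Lemma prod_mpolyX_indic (F : {set 'I_r}) : \prod_(i in F) mX (mnm1 i) = mX (indic F).
Proof.
rewrite mpolyXE_id big_mkcond; apply: eq_bigr => i _.
by rewrite /indic mnmE; case: ifP; rewrite ?expr1 ?expr0.
Qed.

Lemma stanley_reisner_mono : stanley_reisner_set D = mono_ideal K nonface.
Proof.
apply/seteqP; split.
  apply: ideal_gen_sub; first exact: (is_ideal_mono K nonface_up).
  move=> _ [F /= FD <-]; rewrite prod_mpolyX_indic; apply/mono_idealX.
  rewrite /nonface; suff -> : exp_support (indic F) = F by [].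
  by apply/setP => i; rewrite inE mnmE; case: (i \in F).
apply: (@mono_ideal_sub K r P idfun (stanley_reisner_set D)).
  exact: is_ideal_gen.
move=> m mD /=; have [_ _] := is_ideal_gen
  [set (\prod_(i in F) mX (mnm1 i) : P) | F in [set F : {set 'I_r} | F \notin D]].
have -> : m = mnm_sub m (indic (exp_support m)) +m indic (exp_support m).
  rewrite submK //; apply/mnm_lepP => i; rewrite mnmE inE.
  by case: (m i).
rewrite mpolyXD; apply; apply: sub_ideal_gen.
by exists (exp_support m) => //; rewrite prod_mpolyX_indic.
Qed.

Definition fr_pi (p : P) : A :=
  \pi_({ideal_quot (stanley_reisner (K := K) D)})%qT p.

Lemma fr_pi_zmod : zmod_morphism fr_pi. Proof. exact: rmorphB. Qed.

Lemma fr_pi_monoid : monoid_morphism fr_pi.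
Proof. by split; [exact: rmorph1|exact: rmorphM]. Qed.

HB.instance Definition _ := GRing.isZmodMorphism.Build P A fr_pi fr_pi_zmod.
HB.instance Definition _ := GRing.isMonoidMorphism.Build P A fr_pi fr_pi_monoid.

Lemma fr_pi_surj (y : A) : exists p, y = fr_pi p.
Proof. by exists (repr y); rewrite /fr_pi reprK. Qed.

Lemma fr_pi_eqP (p q : P) : fr_pi p = fr_pi q <-> mono_ideal K nonface (p - q).
Proof.
rewrite -stanley_reisner_mono; split=> [/eqP|/mem_set pq].
  by rewrite -Quotient.idealrBE => /set_mem.
by apply/eqP; rewrite -Quotient.idealrBE.
Qed.

Lemma fr_pi_nonface m : nonface m -> fr_pi (mX m) = 0.
Proof.
by move=> mD; rewrite -(rmorph0 fr_pi); apply/fr_pi_eqP; rewrite subr0; apply/mono_idealX.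
Qed.

(** The sets of exponents of the monomial ideals that contain the
    Stanley-Reisner ideal: for these, membership in the image in the face ring
    can be read off any representative ([face_mono_idealE]). *)
Definition admissible T : Prop := up_closed T /\ (forall m, nonface m -> T m).

Definition face_mono_ideal T : set A := fr_pi @` mono_ideal K T.

Lemma face_mono_idealE T (p : P) : admissible T ->
  face_mono_ideal T (fr_pi p) <-> mono_ideal K T p.
Proof.
move=> [upT faT]; split=> [[q Tq /fr_pi_eqP qp]|]; last by exists p.
rewrite -(subKr q p); apply: (ideal_sub (is_ideal_mono K upT)) => // m /qp.
exact: faT.
Qed.

Lemma face_mono_idealX T m : admissible T ->
  face_mono_ideal T (fr_pi (mX m)) <-> T m.
Proof. by move=> /face_mono_idealE ->; apply: mono_idealX. Qed.

Lemma is_ideal_face_mono T : up_closed T -> is_ideal (face_mono_ideal T).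
Proof.
move=> upT; have [I0 ID IM] := is_ideal_mono K upT; split.
- by exists 0; rewrite ?rmorph0.
- by move=> _ _ [p Tp <-] [q Tq <-]; exists (p + q); rewrite ?rmorphD //; apply: ID.
move=> y _ [q Tq <-]; have [p ->] := fr_pi_surj y.
by exists (p * q); rewrite ?rmorphM //; apply: IM.
Qed.

Lemma face_mono_ideal_sub T (I : set A) : is_ideal I ->
  (forall m, T m -> I (fr_pi (mX m))) -> face_mono_ideal T `<=` I.
Proof.
by move=> I_ IX _ [p Tp <-]; exact: (@mono_ideal_sub K r A fr_pi I T I_ IX p Tp).
Qed.

(** Adding to T a missing exponent of maximal degree keeps it up-closed, so the
    missing monomials can be added to the ideal one at a time. *)
Lemma face_mono_chain_ge T (s : seq (multinom r)) : admissible T -> uniq s ->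
  (forall m, (m \in s) = ~~ T m) ->
  has_chain [set J : set A | is_ideal J /\ face_mono_ideal T `<=` J] (size s).
Proof.
move: {2}(size s) (erefl (size s)) => N; elim: N s T => [|N IH] s T sN adT us sE.
  rewrite sN; exists (fun=> face_mono_ideal T); split=> // i _; split=> //.
  by apply: is_ideal_face_mono; case: adT.
have [upT faT] := adT.
have [m ms mmax] : exists2 m, m \in s & forall a, a \in s -> (mdeg a <= mdeg m)%N.
  case: s sN {us sE} => // m0 s _.
  have [m mS mmax] := @arg_maxnP (seq_sub (m0 :: s)) (SeqSub (mem_head m0 s))
    xpredT (mdeg \o val) isT.
  exists (val m); first exact: valP.
  by move=> a aS; apply: (mmax (SeqSub aS)).
pose T' := [pred a | T a || (a == m)].
have adT' : admissible T'.
  split=> [a b|a /faT Ta]; last by rewrite /= Ta.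
  move=> /orP[Ta|/eqP ->]; first by rewrite /= upT.
  rewrite /=; apply/orP; have [Tmb|Tmb] := boolP (T (m +m b)); first by left.
  right; move: Tmb; rewrite -sE => /mmax.
  rewrite mdegD -[X in (_ <= X)%N]addn0 leq_add2l leqn0 mdeg_eq0 => /eqP->.
  by rewrite addm0.
have rN : size (rem m s) = N by rewrite size_rem // sN.
have [||c [cI cS]] := IH (rem m s) T' rN adT'; first exact: rem_uniq.
  by move=> a; rewrite (rem_filter _ us) mem_filter sE /= negb_or andbC.
rewrite rN in cI cS; rewrite sN.
exists (fun i => if i is i'.+1 then c i' else face_mono_ideal T).
split=> [[|i]|[|i]] iN.
- by split=> //; apply: is_ideal_face_mono.
- have [Ic Tc] := cI i iN; split=> //; apply: subset_trans Tc.
  by move=> _ [p Tp <-]; exists p => // a /Tp Ta; rewrite /= Ta.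
- have [Ic Tc] := cI 0%N isT; split=> [|cT].
    by apply: subset_trans Tc => _ [p Tp <-]; exists p => // a /Tp Ta; rewrite /= Ta.
  have : face_mono_ideal T (fr_pi (mX m))
    by apply/cT/Tc/(face_mono_idealX m adT'); rewrite /= eqxx orbT.
  by rewrite (face_mono_idealX m adT); apply/negP; rewrite -sE.
exact: cS.
Qed.

(** Choose p_i in the i-th difference of the chain.  The coefficient vectors of
    the p_i at the missing exponents s are linearly independent, so there are at
    most size s of them: in a vanishing combination, the last p_i with a nonzero
    coefficient would be a combination of the previous ones modulo the smallest
    ideal, hence would belong to the i-th ideal. *)
Lemma face_mono_chain_le T (s : seq (multinom r)) (n : nat) :
  (forall m, (m \in s) = ~~ T m) ->
  has_chain [set J : set A | is_ideal J /\ face_mono_ideal T `<=` J] n ->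
  (n <= size s)%N.
Proof.
move=> sE [c [cI cS]].
have cmono i j : (i <= j <= n)%N -> c i `<=` c j.
  move=> /andP[]; elim: j => [|j IH]; first by rewrite leqn0 => /eqP -> _ y.
  rewrite leq_eqVlt => /predU1P[-> _ y//|]; rewrite ltnS => ij jn.
  by apply: subset_trans (IH ij (ltnW jn)) _; have [] := cS j jn.
have /choice[p pE] : forall i : 'I_n, exists p, c i.+1 (fr_pi p) /\ ~ c i (fr_pi p).
  move=> i; have [_ /existsNP[y /not_implyP[cy ncy]]] := cS i (ltn_ord i).
  by have [p yp] := fr_pi_surj y; exists p; rewrite -yp.
pose M := \matrix_(i < n, j < size s) mcoeff (nth mnm0 s j) (p i).
suff /eqP <- : row_free M by apply: rank_leq_col.
rewrite -kermx_eq0; apply/eqP/row_matrixP => k; rewrite row0.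
set u := row k _.
have uM : u *m M = 0 by rewrite -row_mul mulmx_ker row0.
apply/eqP/negPn/negP => /rV0Pn[i0 ui0].
have [i ui imax] := @arg_maxnP _ i0 (fun i => u 0 i != 0) (fun i => i : nat) ui0.
have [ci1 nci] := pE i; apply: nci.
have [Ici Tci] : is_ideal (c i) /\ face_mono_ideal T `<=` c i by apply/cI/ltnW.
have [_ _ IM] := Ici.
have uT : mono_ideal K T (\sum_j u 0 j *: p j).
  move=> m; apply: contraR; rewrite -sE => ms.
  move/rowP/(_ (Ordinal (etrans (index_mem m s) ms))): uM.
  rewrite !mxE => uM0; rewrite raddf_sum -[X in _ == X]uM0 /=; apply/eqP.
  by apply: eq_bigr => j _; rewrite mcoeffZ !mxE nth_index.
have uci : c i (fr_pi (u 0 i *: p i)).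
  move: uT; rewrite (bigD1 i) //= => uT.
  rewrite -(addrK (\sum_(j | j != i) u 0 j *: p j) (u 0 i *: p i)) rmorphB.
  apply: ideal_sub => //; first by apply: Tci;
    exists (u 0 i *: p i + \sum_(j | j != i) u 0 j *: p j).
  rewrite rmorph_sum; apply: ideal_sum => // j ji.
  have [->|uj] := eqVneq (u 0 j) 0; first by rewrite scale0r rmorph0; case: Ici.
  rewrite -mul_mpolyC rmorphM; apply: IM.
  have jlt : (j < i)%N by rewrite ltn_neqAle ji; apply: imax.
  by apply: (cmono j.+1); [rewrite jlt ltnW|case: (pE j)].
have -> : p i = mpolyC r (u 0 i)^-1 * (u 0 i *: p i).
  by rewrite mul_mpolyC scalerA mulVf // scale1r.
by rewrite rmorphM; apply: IM.
Qed.

Lemma colength_face_mono_ideal (R : realType) T (s : seq (multinom r)) :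
  admissible T -> uniq s -> (forall m, (m \in s) = ~~ T m) ->
  colength R (face_mono_ideal T) = ((size s)%:R)%:E.
Proof.
move=> adT us sE; apply/eqP; rewrite eq_le; apply/andP; split.
  apply: ge_ereal_sup => _ [n /(face_mono_chain_le sE) ns <-].
  by rewrite lee_fin ler_nat.
by apply: ereal_sup_ubound; exists (size s) => //; apply: face_mono_chain_ge.
Qed.

End FaceRingIdeals.

Arguments face_mono_ideal K {r} D T.

(** * Powers of the Frobenius powers *)

Section Powers.
Variables (K : fieldType) (r : nat) (D : simplicial_complex r).
Implicit Types (m a b : multinom r) (T : pred (multinom r)).
Local Notation P := (mpoly r K).
Local Notation A := (face_ring K D).
Local Notation mX := (@mpolyX r K).

Definition power_exps (w : 'I_r -> nat) (k : nat) : pred (multinom r) :=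
  fun m => nonface D m || (k <= floor_degree w m)%N.

Lemma power_exps_admissible (w : 'I_r -> nat) (k : nat) :
  admissible D (power_exps w k).
Proof.
split=> [a b /orP[/nonface_up Da|ka]|m mD]; rewrite /power_exps ?Da ?mD //.
by rewrite orbC (leq_trans ka) // (leq_trans _ (floor_degreeD _ _ _)) // leq_addr.
Qed.

(** A monomial whose support is not a face vanishes in the face ring, so only
    the others have to be reached by the generators. *)
Lemma ideal_gen_mono (S : set A) T :
  admissible D T -> S `<=` face_mono_ideal K D T ->
  (forall m, T m -> ~~ nonface D m -> ideal_gen S (fr_pi D (mX m))) ->
  ideal_gen S = face_mono_ideal K D T.
Proof.
move=> adT ST TS; apply/seteqP; split.
  by apply: ideal_gen_sub => //; apply: is_ideal_face_mono; case: adT.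
apply: face_mono_ideal_sub; first exact: is_ideal_gen.
move=> m Tm; have [/fr_pi_nonface->|mD] := boolP (nonface D m); last exact: TS.
by have [] := is_ideal_gen S.
Qed.

Section Frobenius.
Variables (v : 'I_r -> nat) (q : nat).
Hypotheses (v_gt0 : forall i, (0 < v i)%N) (q_gt0 : (0 < q)%N).
Let w i := (v i * q)%N.
Let g (t : 'I_r) : A := face_var K D t ^+ v t.

Let w_gt0 i : (0 < w i)%N. Proof. by rewrite muln_gt0 v_gt0. Qed.

Lemma face_var_exp (i : 'I_r) : g i ^+ q = fr_pi D (mX (mpow i (w i))).
Proof. by rewrite -exprM -mpolyXn rmorphXn. Qed.

Lemma divisible_of_floor_degree_gt0 m : (0 < floor_degree w m)%N ->
  exists i m', m = m' +m mpow i (w i).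
Proof.
rewrite /floor_degree lt0n sum_nat_eq0 => /forallPn[i]; rewrite /= -lt0n divn_gt0 // => wm.
exists i, (mnm_sub m (mpow i (w i))); rewrite submK //; apply/mnm_lepP => j.
by rewrite mpowE; case: eqP => // <-.
Qed.

Lemma frobenius_mono_ideal : frobenius_power g q = face_mono_ideal K D (power_exps w 1).
Proof.
apply: ideal_gen_mono; first exact: power_exps_admissible.
  move=> _ [i _ <-]; rewrite face_var_exp; apply/face_mono_idealX.
    exact: power_exps_admissible.
  by rewrite /power_exps -[mpow _ _]add0m floor_degree_shift // orbT.
move=> m /orP[-> //|/divisible_of_floor_degree_gt0[i [m' ->]] _].
rewrite mpolyXD rmorphM /= -face_var_exp.
have [_ _] := is_ideal_gen (range (fun t => g t ^+ q)); apply.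
by apply: sub_ideal_gen; exists i.
Qed.

(** Floor degrees are superadditive, which bounds the products from above;
    conversely a monomial of positive floor degree is divisible by some
    x_i ^ w_i, and dividing by it lowers the floor degree by exactly one. *)
Lemma frobenius_pow_mono_ideal (k : nat) :
  ideal_pow (frobenius_power g q) k = face_mono_ideal K D (power_exps w k).
Proof.
elim: k => [|k IH] /=.
  apply/seteqP; split=> // y _; have [p ->] := fr_pi_surj y.
  by exists p => // m _; rewrite /power_exps orbT.
rewrite IH frobenius_mono_ideal.
apply: ideal_gen_mono; first exact: power_exps_admissible.
  move=> _ [_ [p Tp <-] [_ [p' Tp' <-] <-]]; exists (p * p'); last by rewrite rmorphM.
  move=> m; rewrite -mcoeff_msupp => /msuppM_le /allpairsP[[a b] /= [ap bp ->]].
  have /orP[aD|ak] : power_exps w k a by apply: Tp; rewrite -mcoeff_msupp.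
    by rewrite /power_exps nonface_up.
  have /orP[bD|bk] : power_exps w 1 b by apply: Tp'; rewrite -mcoeff_msupp.
    by rewrite /power_exps addmC nonface_up.
  rewrite /power_exps; apply/orP; right; apply: leq_trans (floor_degreeD _ _ _).
  by rewrite -addn1 leq_add.
move=> m /orP[-> //|km].
have [|i [m' mE] mD] := @divisible_of_floor_degree_gt0 m; first exact: leq_ltn_trans km.
move: km; rewrite mE floor_degree_shift // ltnS => km.
rewrite mpolyXD rmorphM; apply: sub_ideal_gen.
exists (fr_pi D (mX m')).
  apply/face_mono_idealX; first exact: power_exps_admissible.
  by rewrite /power_exps km orbT.
exists (fr_pi D (mX (mpow i (w i)))) => //.
apply/face_mono_idealX; first exact: power_exps_admissible.
by rewrite /power_exps -[mpow _ _]add0m floor_degree_shift // orbT.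
Qed.

End Frobenius.

(** * Primes attached to faces *)

(** The exponents of the ideal generated by the x_i with i outside G. *)
Definition off_face (G : {set 'I_r}) : pred (multinom r) :=
  fun m => ~~ (exp_support m \subset G).

Lemma off_face_admissible (G : {set 'I_r}) : G \in D -> admissible D (off_face G).
Proof.
move=> GD; split=> [a b|m]; rewrite /off_face ?/nonface; apply: contra.
  by rewrite exp_supportD finset.subUset => /andP[].
by move=> mG; apply: faces_sub GD.
Qed.

(** The endomorphism killing the variables outside G.  The ideal of [off_face G]
    is its kernel, hence prime. *)
Definition face_restrict (G : {set 'I_r}) : P -> P :=
  mmap (@mpolyC r K) (fun i => if i \in G then mX (mnm1 i) else 0).

Lemma face_restrictX (G : {set 'I_r}) m :
  face_restrict G (mX m) = if exp_support m \subset G then mX m else 0.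
Proof.
rewrite /face_restrict mmapX /mmap1 mpolyXE_id; case: ifPn => [/fintype.subsetP mG|].
  apply: eq_bigr => i _; case: ifPn => // iG.
  suff -> : m i = 0%N by [].
  by apply/eqP/negPn; apply: contra iG => mi; apply: mG; rewrite inE.
case/fintype.subsetPn => i; rewrite inE => mi iG.
by rewrite (bigD1 i) //= (negbTE iG) expr0n (negbTE mi) mul0r.
Qed.

Lemma face_restrict_eq0 (G : {set 'I_r}) (p : P) :
  face_restrict G p = 0 <-> mono_ideal K (off_face G) p.
Proof.
have rE m : mcoeff m (face_restrict G p) =
    if exp_support m \subset G then mcoeff m p else 0.
  have -> : mcoeff m (face_restrict G p) =
      \sum_(a <- msupp p) mcoeff a p * mcoeff m (face_restrict G (mX a)).
    rewrite [face_restrict G p]/mmap raddf_sum; apply: eq_bigr => a _ /=.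
    by rewrite [face_restrict G _]mmapX mul_mpolyC mcoeffZ.
  case: ifPn => mG.
    rewrite [in RHS](mpolyE p) raddf_sum /=; apply: eq_bigr => a _.
    rewrite mcoeffZ face_restrictX; have [->|am] := eqVneq a m; first by rewrite mG.
    by case: ifP => _; rewrite ?mcoeff0 // mcoeffX (negbTE am).
  rewrite big1 // => a _; rewrite face_restrictX; case: ifP => aG.
    by rewrite mcoeffX; case: eqP aG mG => [->->//|]; rewrite mulr0.
  by rewrite mcoeff0 mulr0.
split=> [p0 m|Gp]; last first.
  apply/mpolyP => m; rewrite mcoeff0 rE; case: ifPn => // mG.
  by apply/eqP/negPn/negP => /Gp; rewrite /off_face mG.
by apply: contra => mG; have := rE m; rewrite p0 mcoeff0 mG => <-.
Qed.

Lemma off_face_prime (G : {set 'I_r}) : G \in D ->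
  is_prime_ideal (face_mono_ideal K D (off_face G)).
Proof.
move=> GD; have adG := off_face_admissible GD; split.
- by apply: is_ideal_face_mono; case: adG.
- rewrite -(rmorph1 (fr_pi D)) => /(face_mono_idealE _ adG) /(_ mnm0).
  rewrite mcoeff1 eqxx oner_eq0 => /(_ isT) /negP[].
  by apply/fintype.subsetP => i; rewrite inE mnm0E.
move=> y z; have [p ->] := fr_pi_surj y; have [q ->] := fr_pi_surj z.
rewrite -rmorphM => /(face_mono_idealE _ adG) /face_restrict_eq0.
rewrite /face_restrict rmorphM => /eqP.
rewrite mulf_eq0 => /orP[] /eqP /face_restrict_eq0 H; [left|right]; exact/face_mono_idealE.
Qed.

(** Removing an element from a face G adds one variable to the prime of G. *)
Lemma face_prime_chain (F : {set 'I_r}) : F \in D ->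
  has_chain (@is_prime_ideal A) #|F|.
Proof.
suff H n (G : {set 'I_r}) : #|G| = n -> G \in D -> exists c : nat -> set A,
    [/\ c 0%N = face_mono_ideal K D (off_face G),
        forall i, (i <= n)%N -> is_prime_ideal (c i) &
        forall i, (i < n)%N -> c i `<` c i.+1].
  by move=> FD; have [c [_ cI cS]] := H _ _ erefl FD; exists c.
elim: n G => [|n IH] G Gn GD.
  by exists (fun=> face_mono_ideal K D (off_face G)); split=> // i _; apply: off_face_prime.
have /card_gt0P[x xG] : (0 < #|G|)%N by rewrite Gn.
have GxD : G :\ x \in D by apply: faces_sub GD; apply: subD1set.
have [|c [c0 cI cS]] := IH (G :\ x) _ GxD.
  by apply: succn_inj; rewrite -Gn (cardsD1 x G) xG.
exists (fun i => if i is i'.+1 then c i' else face_mono_ideal K D (off_face G)).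
split=> // [[|i] iN|[|i] iN]; [exact: off_face_prime|exact: cI| |exact: cS].
rewrite c0; split=> [_ [p Gp <-]|sub].
  exists p => // m /Gp; apply: contra => /fintype.subset_trans; apply; exact: subD1set.
have : face_mono_ideal K D (off_face G) (fr_pi D (mX (mnm1 x))).
  apply: sub; apply/face_mono_idealX; first exact: off_face_admissible.
  apply/fintype.subsetPn; exists x; rewrite !inE ?mnm1E ?eqxx //.
move/(face_mono_idealX K _ (off_face_admissible GD)) => /negP[].
by apply/fintype.subsetP => i; rewrite inE mnm1E; have [<-|] := eqVneq x i.
Qed.

End Powers.

(** * Hilbert-Samuel coefficients *)

(** The first difference in n of C(n + j + 1, j + 1) is C(n + 1 + j, j), so
    taking differences shifts the coefficients down by one. *)
Lemma binomial_basis (d N : nat) (c : nat -> int) :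
  (forall n, (N <= n)%N -> \sum_(j < d.+1) c j * ('C(n + j, j))%:Z = 0) ->
  forall j, (j <= d)%N -> c j = 0.
Proof.
elim: d N c => [|d IH] N c H j.
  rewrite leqn0 => /eqP ->; have := H N (leqnn N).
  by rewrite big_ord1 bin0 mulr1.
have cS : forall i, (i <= d)%N -> c i.+1 = 0.
  apply: (IH N.+1 (fun i => c i.+1)) => -[//|n] Nn.
  have := congr2 (fun x y : int => x - y) (H n.+1 (ltnW Nn)) (H n Nn).
  rewrite -sumrB subrr big_ord_recl /= !bin0 subrr add0r; apply: etrans; apply: eq_bigr => i _.
  rewrite -mulrBr; congr (_ * _); rewrite /bump /= add1n (addSnnS n i).
  by rewrite (addSn n) binS PoszD addrAC subrr add0r.
case: j => [_|j]; last exact: cS.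
have := H N (leqnn N); rewrite big_ord_recl bin0 mulr1 big1 ?addr0 // => i _.
by rewrite cS ?mul0r // -ltnS.
Qed.

Lemma hilbert_samuel_uniq (R : realType) (A : comNzRingType) (d : nat)
    (I : set A) (e e' : {ffun 'I_d.+1 -> int}) :
  hilbert_samuel R I e -> hilbert_samuel R I e' -> e = e'.
Proof.
move=> [N _ eN] [N' _ eN'].
(* The j-th binomial basis element carries the coefficient e_(d - j). *)
pose c j := (-1) ^+ (d - j) * (e (inord (d - j)) - e' (inord (d - j))).
have c0 : forall j, (j <= d)%N -> c j = 0.
  apply: (binomial_basis (N := maxn N N')) => n; rewrite geq_max => /andP[Nn N'n].
  have := eN n.+1 (leqW Nn); rewrite /= (eN' n.+1 (leqW N'n)) => -[] /intr_inj E.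
  move/eqP: E; rewrite eq_sym -subr_eq0 -sumrB => /eqP; apply: etrans.
  rewrite [RHS](reindex_inj rev_ord_inj); apply: eq_bigr => i _.
  have id : (i <= d)%N by rewrite -ltnS.
  have -> : rev_ord i = inord (d - i).
    by apply: val_inj; rewrite /= inordK ?subSS // ltnS leq_subr.
  rewrite -mulrBl -mulrBr inordK ?ltnS ?leq_subr // subKn // addSn subSS subn0.
  by rewrite -addnBA ?leq_subr // subKn.
apply/ffunP => i; have id : (i <= d)%N by rewrite -ltnS.
have := c0 (d - i)%N (leq_subr _ _); rewrite /c subKn // inord_val => /eqP.
by rewrite mulf_eq0 signr_eq0 /= subr_eq0 => /eqP.
Qed.

Lemma hs_coef_unique (R : realType) (A : comNzRingType) (d : nat)
    (I : set A) (e : {ffun 'I_d.+1 -> int}) :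
  hilbert_samuel R I e -> hs_coef R d I = e.
Proof.
by move=> eI; apply: xget_unique => // e' /hilbert_samuel_uniq; apply.
Qed.

(** The faces with d - i elements contribute to the i-th term.  The sign in c
    cancels the alternating sign in the Hilbert-Samuel convention. *)
Lemma colength_frobenius_pow (R : realType) (K : fieldType) (r d : nat)
    (D : simplicial_complex r) (v : 'I_r -> nat) :
  (forall i, (0 < v i)%N) -> (forall F, F \in D -> (#|F| <= d)%N) ->
  exists c : 'I_d.+1 -> int, forall q k : nat, (0 < q)%N -> (0 < k)%N ->
    colength R (ideal_pow (frobenius_power (fun i => face_var K D i ^+ v i) q) k)
    = ((\sum_(i < d.+1) (-1) ^+ i * (c i * (q ^ (d - i))%N%:Z)
         * ('C(k + d - 1 - i, d - i))%:Z)%:~R : R)%:E.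
Proof.
move=> v0 Dd; have [chi [chi0 chiE]] := count_face_exps D.
exists (fun i : 'I_d.+1 => (-1) ^+ i *
  \sum_(G in D | inord (d - #|G|) == i) chi G * (\prod_(j in G) v j)%N%:Z).
move=> q k q0 k0; pose w i := (v i * q)%N.
have w0 i : (0 < w i)%N by rewrite muln_gt0 v0.
have [s us [sE ss]] := chiE w k w0 k0.
rewrite (frobenius_pow_mono_ideal K D v0 q0 k).
rewrite (colength_face_mono_ideal K R (power_exps_admissible D w k) us); last first.
  by move=> m; rewrite sE negb_or negbK ltnNge.
congr _%:E; rewrite pmulrn ss; congr _%:~R.
rewrite (bigID (mem D)) /= [X in _ + X]big1 ?addr0; last first.
  by move=> G GD; rewrite chi0 // mul0r.
rewrite (partition_big (fun G : {set 'I_r} => inord (d - #|G|) : 'I_d.+1) xpredT) //=.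
apply: eq_bigr => i _; rewrite !mulrA -exprD addnn -mul2n exprM sqrrN !expr1n mul1r.
rewrite -!mulrA mulr_suml; apply: eq_bigr => G /andP[GD /eqP <-].
rewrite inordK ?ltnS ?leq_subr // subKn ?Dd // -mulrA; congr (_ * _).
rewrite big_split /= prod_nat_const !PoszM -!mulrA; congr (_ * (_ * Posz 'C(_, _))).
by move: #|G| (Dd G GD) k0 => g gd k0; clear -gd k0; lia.
Qed.

(** * The limits *)

Lemma cvg_finite_sum (R : realType) (I : Type) (s : seq I) (f : I -> nat -> R)
    (l : I -> R) :
  (forall i, f i q @[q --> \oo] --> l i) ->
  \sum_(i <- s) f i q @[q --> \oo] --> \sum_(i <- s) l i.
Proof.
move=> fl; elim: s => [|i s IH].
  by rewrite big_nil; under eq_fun do rewrite big_nil; apply: cvg_cst.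
by rewrite big_cons; under eq_fun do rewrite big_cons; apply: cvgD.
Qed.

Lemma cvg_natpow_ratio (R : realType) (d i : nat) (c : int) : (i <= d)%N ->
  (c * (q ^ (d - i))%N%:Z)%:~R / (q%:R ^+ d) @[q --> \oo] --> (c%:~R * 0 ^+ i : R).
Proof.
move=> id.
have u0 : (q%:R : R)^-1 @[q --> \oo] --> 0.
  by apply/gtr0_cvgV0; [exists 1%N => // q /= q0; rewrite ltr0n|exact: cvgr_idn].
have H : c%:~R * (q%:R^-1) ^+ i @[q --> \oo] --> (c%:~R * 0 ^+ i : R).
  apply: cvgM; first exact: cvg_cst.
  exact: (cvg_comp _ _ u0 (@exprn_continuous R i 0)).
apply: cvg_trans H; apply: near_eq_cvg; exists 1%N => // q /= q0.
have qN0 : q%:R != 0 :> R by rewrite pnatr_eq0 -lt0n.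
rewrite intrM -pmulrn natrX -mulrA; congr (_ * _).
by rewrite -{2}(subnK id) exprD invfM mulrA divff ?mul1r ?exprVn // expf_neq0.
Qed.

Theorem theorem1p5 (R : realType) (K : fieldType) (r : nat)
    (Delta : simplicial_complex r) (d : nat)
    (hd : is_krull_dim (face_ring K Delta) d)
    (v : 'I_r -> nat) (hv : forall i, (0 < v i)%N) :
  let x_v := fun i : 'I_r => face_var K Delta i ^+ v i in
  let J := ideal_gen (range x_v) in
  let Jfrob := fun q : nat => frobenius_power x_v q in
  [/\ (forall q : nat, (0 < q)%N ->
         hilbert_samuel R (Jfrob q) (hs_coef R d (Jfrob q))),
      (forall i : 'I_d.+1, (1 <= i)%N ->
         (hs_coef R d (Jfrob q) i)%:~R / (q%:R ^+ d) @[q --> \oo] --> (0 : R)) &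
      (forall k : nat, (1 <= k)%N ->
         (colength R (ideal_pow (Jfrob q) k) * ((q%:R ^+ d)^-1)%:E)%E
           @[q --> \oo] -->
         ((hs_coef R d J ord0)%:~R * ('C(k + d - 1, d))%:R : R)%:E)].
Proof.
move=> x_v J Jfrob.
have facet_le F : F \in Delta -> (#|F| <= d)%N.
  by move=> FD; apply: hd.2; apply: face_prime_chain.
have [c cE] := colength_frobenius_pow R K hv facet_le.
pose e q : {ffun 'I_d.+1 -> int} := [ffun i : 'I_d.+1 => c i * (q ^ (d - i))%N%:Z].
have hs_e q : (0 < q)%N -> hilbert_samuel R (Jfrob q) (e q).
  move=> q0; exists 1%N => // n /= n0; rewrite cE //; congr (_ %:~R)%:E.
  by apply: eq_bigr => i _; rewrite ffunE.
have coefE q : (0 < q)%N -> hs_coef R d (Jfrob q) = e q.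
  by move=> q0; apply/hs_coef_unique/hs_e.
split=> [q q0|i i0|k k0].
- by rewrite coefE //; apply: hs_e.
- have := @cvg_natpow_ratio R d i (c i) (ltn_ord i).
  rewrite expr0n (gtn_eqF i0) mulr0; apply: cvg_trans; apply: near_eq_cvg.
  by exists 1%N => // q /= q0; rewrite coefE // ffunE.
have -> : hs_coef R d J ord0 = c ord0.
  have -> : J = Jfrob 1%N by [].
  by rewrite coefE // ffunE exp1n mulr1.
have H : \sum_(i < d.+1) ((-1) ^+ i * ('C(k + d - 1 - i, d - i))%:R) *
    ((c i * (q ^ (d - i))%N%:Z)%:~R / (q%:R ^+ d)) @[q --> \oo] -->
    ((c ord0)%:~R * ('C(k + d - 1, d))%:R : R).
  have -> : (c ord0)%:~R * ('C(k + d - 1, d))%:R =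
      \sum_(i < d.+1) ((-1) ^+ i * ('C(k + d - 1 - i, d - i))%:R) *
        ((c i)%:~R * 0 ^+ i) :> R.
    rewrite big_ord_recl big1 ?addr0 => [|i _]; last by rewrite expr0n !mulr0.
    by rewrite !expr0 !subn0 mul1r mulr1 mulrC.
  apply: cvg_finite_sum => i; apply: cvgM; first exact: cvg_cst.
  by apply: cvg_natpow_ratio; rewrite -ltnS.
have : (\sum_(i < d.+1) ((-1) ^+ i * ('C(k + d - 1 - i, d - i))%:R) *
    ((c i * (q ^ (d - i))%N%:Z)%:~R / (q%:R ^+ d)))%:E @[q --> \oo] -->
    ((c ord0)%:~R * ('C(k + d - 1, d))%:R : R)%:E.
  by apply: cvg_EFin => //; apply: nearW.
apply: cvg_trans; apply: near_eq_cvg; exists 1%N => // q /= q0.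
rewrite cE // -EFinM; congr _%:E; rewrite rmorph_sum mulr_suml /=.
apply: eq_bigr => i _; rewrite !rmorphM /= rmorph_sign !mulrA; congr (_ / _).
by rewrite -!pmulrn; ring.
Qed.
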